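(* For every $k\in\mathbb{N}$ and $\delta,C>0$ there exists $\varepsilon>0$ such that the following holds. Let $Z$ be a finite abelian group and let $f:Z\to\mathbb{C}$ be a function with $|f|\le1$ satisfying $|\langle f,\phi_{*\tau}\rangle|\ge\delta$ for some projected $k$-step nilsequence $\phi_{*\tau}$ on $Z$ of complexity at most $C$. Then $\|f\|_{U^{k+1}}\ge\varepsilon$.
   Context: $\mathbb{E}$ denotes the average over a finite set and $\langle f,g\rangle=\mathbb{E}_{x\in Z}f(x)\overline{g(x)}$. The Gowers norm is $\|f\|_{U^{d}}^{2^d}=\mathbb{E}_{x,h_1,\dots,h_d\in Z}\prod_{v\in\{0,1\}^d}\mathcal{C}^{|v|}f(x+v_1h_1+\dots+v_dh_d)$, where $\mathcal{C}$ is complex conjugation and $|v|=\sum v_i$. Nilspaces. Let $[k]=\{1,\dots,k\}$. A discrete-cube morphism $\{0,1\}^m\to\{0,1\}^n$ is the restriction of an affine homomorphism $\mathbb{Z}^m\to\mathbb{Z}^n$. A face of $\{0,1\}^n$ of codimension $r$ is a subset obtained by fixing $r$ coordinates; a face map is an injective discrete-cube morphism whose image is a face. A nilspace is a set $X$ with sets of $n$-cubes $C^n(X)\subset X^{\{0,1\}^n}$, $n\ge0$, such that: (composition) $c\circ\phi\in C^m(X)$ for all $c\in C^n(X)$ and all discrete-cube morphisms $\phi:\{0,1\}^m\to\{0,1\}^n$; (ergodicity) $C^1(X)=X^{\{0,1\}}$; (corner completion) every $n$-corner, i.e. every $c':\{0,1\}^n\setminus\{1^n\}\to X$ with $c'\circ\phi\in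 C^{n-1}(X)$ for every face map $\phi:\{0,1\}^{n-1}\to\{0,1\}^n$ with image in $\{0,1\}^n\setminus\{1^n\}$, extends to an element of $C^n(X)$ (a completion). $X$ is $k$-step if every $(k+1)$-corner has a unique completion. Morphisms are maps $\varphi$ with $\varphi\circ c$ a cube for every cube $c$. A compact nilspace is a nilspace with a compact second-countable Hausdorff topology such that all $C^n(X)$ are closed; isomorphisms of compact nilspaces are homeomorphisms that are morphisms in both directions. Define $x\sim_i y$ iff there are $c_0,c_1\in C^{i+1}(X)$ agreeing on $\{0,1\}^{i+1}\setminus\{0^{i+1}\}$ with $c_0(0^{i+1})=x$, $c_1(0^{i+1})=y$; $\pi_i:X\to X_i=X/\!\sim_i$ is the $i$-step factor, with cubes $\pi_i\circ c$, $c\in C^n(X)$. For an abelian group $A$, $\mathcal{D}_i(A)$ is the nilspace on $A$ whose $n$-cubes form the subgroup of $A^{\{0,1\}^n}$ generated by the elements equal to some $a\in A$ on a face of codimension $\le i$ and $0$ elsewhere. The $i$-th structure group $A_i$ of a $k$-step nilspace $X$ is the abelian group acting freely on $X_i$, with orbits the fibers of $X_i\to X_{i-1}$, such that for each $c\in C^n(X_i)$ the cubes with the same projection to $X_{i-1}$ as $c$ are exactly $c+d$, $d\in C^n(\mathcal{D}_i(A_i))$; for compact $X$ it is a compact abelian group. A $k$-step compact nilspace is compact finite-rank (CFR) if all its structure groups are compact abelian Lie groups. Filtered nilmanifolds. A filtration of degree $k$ on a group $G$ is a sequence of subgroups $G=G_0=G_1\ge G_2\ge\cdots$ with $[G_i,G_j]\subset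 G_{i+j}$ and $G_{k+1}=\{1\}$. $C^n(G_\bullet)$ is the subgroup of $G^{\{0,1\}^n}$ generated by the elements $g^F$ (equal to $g$ on the face $F$, and to $1$ elsewhere), $g\in G_{\mathrm{codim}(F)}$. A filtered nilmanifold of degree $k$, $(G/\Gamma,G_\bullet)$, consists of a nilpotent Lie group $G$ (not necessarily connected), a discrete cocompact subgroup $\Gamma$, and a degree-$k$ filtration $G_\bullet$ of closed subgroups with each $\Gamma\cap G_i$ cocompact in $G_i$; it is a $k$-step CFR nilspace with cubes the images of $C^n(G_\bullet)$ in $(G/\Gamma)^{\{0,1\}^n}$. A polynomial map $g:Z'\to G/\Gamma$ relative to $G_\bullet$, for an abelian group $Z'$, is a nilspace morphism $\mathcal{D}_1(Z')\to G/\Gamma$. Complexity. Once and for all one fixes an enumeration of the (countably many) isomorphism classes of CFR nilspaces by positive integers, and for each class a representative $X_i$ with a compatible metric. A nilsequence $F\circ g$ on $Z'$ (with $g:Z'\to G/\Gamma$ polynomial and $F:G/\Gamma\to\mathbb{C}$ continuous, $|F|\le1$) has complexity at most $C$ if, for some $i\le C$, there is an isomorphism of compact nilspaces $\theta:X_i\to G/\Gamma$ such that $F\circ\theta$ is Lipschitz with constant at most $C$. A projected $k$-step nilsequence on $Z$ is a function of the form $\phi_{*\tau}(x)=\mathbb{E}_{y\in\tau^{-1}(x)}F(g(y))$, where $\tau:Z'\to Z$ is a surjective homomorphism from a finite abelian group $Z'$, $(G/\Gamma,G_\bullet)$ is a filtered nilmanifold of degree $k$, $g:Z'\to G/\Gamma$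 is a polynomial map relative to $G_\bullet$, and $F:G/\Gamma\to\mathbb{C}$ is continuous with $|F|\le1$. It has complexity at most $C$ if $F\circ g$ has complexity at most $C$. *)

(* Defs.v *)
From HB Require Import structures.
From mathcomp Require Import all_boot all_order all_algebra.
From mathcomp Require Import complex.
From mathcomp Require Import all_classical all_reals all_analysis.

Set Implicit Arguments.
Unset Strict Implicit.
Unset Printing Implicit Defensive.

Import Order.TTheory GRing.Theory Num.Theory.
Import numFieldNormedType.Exports.

Local Open Scope classical_set_scope.
Local Open Scope ring_scope.
Local Open Scope complex_scope.
Local Open Scope quotient_scope.

Section Averages.
Variable R : realType.

Definition avg (T : finType) (A : {set T}) (f : T -> R[i]) : R[i] :=
  (\sum_(x in A) f x) / #|A|%:R.

Definition inner (Z : finType) (f g : Z -> R[i]) : R[i] :=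
  avg [set: Z] (fun x => f x * (g x)^*).

End Averages.

Definition cube (n : nat) : finType := {ffun 'I_n -> bool}.
Definition cube0 (n : nat) : cube n := [ffun => false].
Definition cube1 (n : nat) : cube n := [ffun => true].
Definition weight (n : nat) (v : cube n) : nat := #|[set i | v i]%SET|.

(* The average is a nonnegative real for d > 0, and [m.-root] is then its     *)
(* nonnegative real m-th root.                                                *)
Definition gowers_norm (R : realType) (Z : finZmodType) (d : nat)
    (f : Z -> R[i]) : R[i] :=
  (2 ^ d).-root (avg [set: Z * {ffun 'I_d -> Z}] (fun xh =>
    \prod_(v : cube d)
      iter (weight v) Num.conj (f (xh.1 + \sum_(i < d) xh.2 i *+ v i)))).

Definition cube_vec (n : nat) (v : cube n) : 'rV[int]_n := \row_i (v i)%:R.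

Definition cube_morphism (m n : nat) (phi : cube m -> cube n) : Prop :=
  exists (A : 'M[int]_(m, n)) (b : 'rV[int]_n),
    forall v, cube_vec (phi v) = cube_vec v *m A + b.

(* The face on which the coordinates in S agree with those of a; its          *)
(* codimension is #|S|.                                                       *)
Definition face (n : nat) (S : {set 'I_n}) (a : cube n) : {set cube n} :=
  [set v : cube n | [forall i in S, v i == a i]]%SET.

Definition face_map (m n : nat) (phi : cube m -> cube n) : Prop :=
  [/\ cube_morphism phi, injective phi &
      exists (S : {set 'I_n}) (a : cube n), phi @: [set: cube m]%SET = face S a].

Definition cubespace (X : Type) := forall n : nat, set (cube n -> X).

Section Nilspaces.
Variables (X : Type) (C : cubespace X).

(* A corner is a map on the cube minus its top vertex: the value of c' at     *)
(* [cube1] is never used.                                                     *)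
Definition corner (n : nat) (c' : cube n.+1 -> X) : Prop :=
  forall phi : cube n -> cube n.+1,
    face_map phi -> (forall v, phi v != cube1 n.+1) -> C (c' \o phi).

Definition completion (n : nat) (c' c : cube n -> X) : Prop :=
  C c /\ forall v, v != cube1 n -> c v = c' v.

Record nilspace : Prop := Nilspace {
  nilspace_comp : forall (m n : nat) (c : cube n -> X) (phi : cube m -> cube n),
    cube_morphism phi -> C c -> C (c \o phi);
  nilspace_ergodic : forall c : cube 1 -> X, C c;
  nilspace_corner : forall (n : nat) (c' : cube n.+1 -> X),
    corner c' -> exists c, completion c' c }.

Definition step (k : nat) : Prop :=
  forall c' : cube k.+1 -> X, corner c' -> exists! c, completion c' c.

Definition nil_rel (i : nat) (x y : X) : Prop :=
  exists c0 c1 : cube i.+1 -> X,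
    [/\ C c0, C c1, forall v, v != cube0 i.+1 -> c0 v = c1 v,
        c0 (cube0 i.+1) = x & c1 (cube0 i.+1) = y].

End Nilspaces.

Definition nil_morphism (X Y : Type) (C : cubespace X) (D : cubespace Y)
    (phi : X -> Y) : Prop :=
  forall (n : nat) (c : cube n -> X), C n c -> D n (phi \o c).

Record compact_nilspace (X : topologicalType) (C : cubespace X) : Prop :=
  CompactNilspace {
    compact_nilspace_nilspace :> nilspace C;
    compact_nilspace_compact : compact [set: X];
    compact_nilspace_second_countable : @second_countable X;
    compact_nilspace_hausdorff : hausdorff_space X;
    compact_nilspace_closed :
      forall n, closed (C n : set {ptws cube n -> X}) }.

Record nil_isomorphism (X Y : topologicalType) (C : cubespace X)
    (D : cubespace Y) (theta : X -> Y) : Prop := NilIsomorphism {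
  nil_isomorphism_continuous : continuous theta;
  nil_isomorphism_morphism : nil_morphism C D theta;
  nil_isomorphism_inverse : exists theta' : Y -> X,
    [/\ cancel theta theta', cancel theta' theta, continuous theta' &
        nil_morphism D C theta'] }.

(* Quotient of T by r, whose points are the classes [set y | r x y]; it is    *)
(* the usual quotient as soon as r is an equivalence relation.                *)

Section Classes.
Variables (T : Type) (r : T -> T -> Prop).

Definition classes : Type := {A : set T | exists x, A = r x}.

Definition classes_pi (x : T) : classes := exist _ (r x) (ex_intro _ x erefl).

Definition classes_repr (A : classes) : T := projT1 (cid (projT2 A)).

Lemma classes_reprK : cancel classes_repr classes_pi.
Proof.
by case=> A PA; apply: eq_exist; rewrite /classes_repr /=; case: cid.
Qed.

HB.instance Definition _ := isQuotient.Build T classes classes_reprK.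

End Classes.

Section Factors.
Variables (X : topologicalType) (C : cubespace X).

Definition nil_factor (i : nat) : topologicalType :=
  quotient_topology (classes (nil_rel C i)).

Definition factor_pi (i : nat) (x : X) : nil_factor i :=
  \pi_(quotient_topology (classes (nil_rel C i))) x.

Definition factor_cubes (i : nat) : cubespace (nil_factor i) :=
  fun n => [set factor_pi i \o c | c in @C n].

(* X_i -> X_(i-1), computed on a representative. *)
Definition factor_proj (i : nat) (p : nil_factor i) : nil_factor i.-1 :=
  factor_pi i.-1
    (repr (p : quotient_topology (classes (nil_rel C i)))).

End Factors.

Definition zsubgroup (A : zmodType) (H : set A) : Prop :=
  H 0 /\ forall x y, H x -> H y -> H (x - y).

Definition face_fun (A : zmodType) (n : nat) (F : {set cube n}) (a : A)
  : cube n -> A := fun v => if v \in F then a else 0.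

Definition Dcubes (i : nat) (A : zmodType) : cubespace A := fun n =>
  smallest (@zsubgroup (cube n -> A))
    [set d | exists (S : {set 'I_n}) (b : cube n) (a : A),
       (#|S| <= i)%N /\ d = face_fun (face S b) a].
Arguments Dcubes i A n _ : clear implicits.

Section Smooth.
Variables (R : realType) (V W : normedModType R).

Fixpoint Cr_on (r : nat) (U : set V) (f : V -> W) : Prop :=
  {in U, continuous f} /\
  if r is r'.+1 then
    forall v : V, (forall x, U x -> derivable f x v) /\
                  Cr_on r' U (fun x => 'D_v f x)
  else True.

Definition smooth_on (U : set V) (f : V -> W) : Prop :=
  forall r, Cr_on r U f.

End Smooth.

(* A homeomorphism between open sets of M and of V. *)
Record chart (R : realType) (M : topologicalType) (V : normedModType R) :=
  Chart {
    chart_dom : set M;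
    chart_cod : set V;
    chart_map : M -> V;
    chart_inv : V -> M;
    _ : open chart_dom;
    _ : open chart_cod;
    _ : set_fun chart_dom chart_cod chart_map;
    _ : set_fun chart_cod chart_dom chart_inv;
    _ : {in chart_dom, cancel chart_map chart_inv};
    _ : {in chart_cod, cancel chart_inv chart_map};
    _ : {in chart_dom, continuous chart_map};
    _ : {in chart_cod, continuous chart_inv} }.

Definition smooth_atlas (R : realType) (M : topologicalType)
    (V : normedModType R) (At : set (chart M V)) : Prop :=
  (forall x : M, exists2 a, At a & chart_dom a x) /\
  forall a b, At a -> At b ->
    smooth_on [set u | chart_cod a u /\ chart_dom b (chart_inv a u)]
              (chart_map b \o chart_inv a).

(* The topological group (M, mul, inv) admits a smooth structure, modelled on *)
(* R^n for some n >= 0, for which mul and inv are smooth in the charts. The   *)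
(* continuity of mul and inv is supposed known (it makes the domains below    *)
(* open).                                                                     *)
Definition lie_group (R : realType) (M : topologicalType)
    (mul : M -> M -> M) (inv : M -> M) : Prop :=
  [/\ hausdorff_space M, @second_countable M &
   exists (n : nat) (At : set (chart M 'rV[R]_n)),
    [/\ smooth_atlas At,
        forall a b c, At a -> At b -> At c ->
          smooth_on
            [set u : 'rV[R]_n * 'rV[R]_n |
               [/\ chart_cod a u.1, chart_cod b u.2 &
                   chart_dom c (mul (chart_inv a u.1) (chart_inv b u.2))]]
            (fun u => chart_map c (mul (chart_inv a u.1) (chart_inv b u.2))) &
        forall a b, At a -> At b ->
          smooth_on [set u | chart_cod a u /\ chart_dom b (inv (chart_inv a u))]
                    (chart_map b \o inv \o chart_inv a)]].

(* A compact group topology on A for which the action is continuous is the    *)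
(* one of the fibres of X_i -> X_(i-1).                                       *)
Record structure_group (X : topologicalType) (C : cubespace X) (i : nat)
    (A : topologicalZmodType) (act : nil_factor C i -> A -> nil_factor C i)
    : Prop :=
  StructureGroup {
    structure_group_act0 : forall p, act p 0 = p;
    structure_group_actD : forall p a b, act p (a + b) = act (act p a) b;
    structure_group_free : forall p a, act p a = p -> a = 0;
    structure_group_orbits : forall p q,
      factor_proj q = factor_proj p <-> exists a, q = act p a;
    structure_group_cubes : forall n (c c' : cube n -> nil_factor C i),
      factor_cubes c ->
      (factor_cubes c' /\
         @factor_proj X C i \o c' = @factor_proj X C i \o c) <->
      exists2 d, Dcubes i A n d & c' = (fun v => act (c v) (d v));
    structure_group_continuous :
      continuous (fun pa : nil_factor C i * A => act pa.1 pa.2);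
    structure_group_compact : compact [set: A] }.

Definition step_CFR (R : realType) (k : nat) (X : topologicalType)
    (C : cubespace X) : Prop :=
  [/\ compact_nilspace C, step C k &
      forall i, (0 < i <= k)%N ->
        exists (A : topologicalZmodType)
               (act : nil_factor C i -> A -> nil_factor C i),
          structure_group act /\ lie_group R (fun a b : A => a + b) -%R].

Definition CFR (R : realType) (X : topologicalType) (C : cubespace X) : Prop :=
  exists k, step_CFR R k C.

(* The representatives are numbered by the positive integers; the value at 0  *)
(* is not used. The topology of a metricType is the one of its metric.        *)
Record CFR_enumeration (R : realType) := CFREnumeration {
  CFR_rep : nat -> metricType R;
  CFR_cubes : forall i, cubespace (CFR_rep i);
  CFR_repP : forall i, (0 < i)%N -> CFR R (@CFR_cubes i);
  CFR_rep_unique : forall (X : topologicalType) (C : cubespace X), CFR R C ->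
    exists! i, (0 < i)%N /\
      exists theta : CFR_rep i -> X, nil_isomorphism (@CFR_cubes i) C theta }.
Arguments CFR_rep {R} E i : rename.
Arguments CFR_cubes {R} E i n _ : rename.

HB.mixin Record isTopologicalGroup G of Group G & Topological G := {
  mulg_continuous : continuous (fun x : G * G => (x.1 * x.2)%g);
  invg_continuous : continuous (fun x : G => (x^-1)%g)
}.

#[short(type="topologicalGroupType")]
HB.structure Definition TopologicalGroup :=
  {G of Group G & Topological G & isTopologicalGroup G}.

Section Groups.
Variable G : groupType.
Implicit Types H : set G.

Definition subgroup H : Prop := H 1%g /\ forall x y, H x -> H y -> H (x / y)%g.

Fixpoint lower_central (n : nat) : set G :=
  if n is m.+1 then
    smallest subgroup
      [set z | exists x y, lower_central m x /\ z = [~ x, y]%g]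
  else [set: G].

Definition nilpotent_group : Prop := exists n, lower_central n = [set 1%g].

Record filtration (k : nat) (Gs : nat -> set G) : Prop := Filtration {
  filtration_subgroup : forall i, subgroup (Gs i);
  filtration_0 : Gs 0 = [set: G];
  filtration_1 : Gs 1 = [set: G];
  filtration_le : forall i, Gs i.+1 `<=` Gs i;
  filtration_commg :
    forall i j x y, Gs i x -> Gs j y -> Gs (i + j)%N [~ x, y]%g;
  filtration_last : Gs k.+1 = [set 1%g] }.

Definition face_elt (n : nat) (F : {set cube n}) (g : G) : {ffun cube n -> G} :=
  [ffun v => if v \in F then g else 1%g].

End Groups.

Definition group_cubes (G : groupType) (Gs : nat -> set G) (n : nat)
  : set {ffun cube n -> G} :=
  smallest (@subgroup {ffun cube n -> G})
    [set c | exists (S : {set 'I_n}) (b : cube n) (g : G),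
       Gs #|S| g /\ c = face_elt (face S b) g].
Arguments group_cubes {G} Gs n _.

(* The classes are the left cosets x Gamma. *)
Definition coset_rel (G : groupType) (Gamma : set G) (x y : G) : Prop :=
  Gamma (x^-1 * y)%g.

Definition coset_space (G : topologicalGroupType) (Gamma : set G)
  : topologicalType := quotient_topology (classes (coset_rel Gamma)).

Definition coset_pi (G : topologicalGroupType) (Gamma : set G) (x : G)
  : coset_space Gamma := \pi_(quotient_topology (classes (coset_rel Gamma))) x.

(* H / (Gamma `&` H), where H has the subspace topology. *)
Definition sub_coset_space (G : topologicalGroupType) (H Gamma : set G)
  : topologicalType :=
  quotient_topology (classes
    (fun x y : set_type H => coset_rel (Gamma `&` H) (set_val x) (set_val y))).

Record nilmanifold (R : realType) (k : nat) := Nilmanifold {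
  nm_group : topologicalGroupType;
  nm_lattice : set nm_group;
  nm_filtration : nat -> set nm_group;
  nm_lie : lie_group R (fun x y : nm_group => (x * y)%g)
                       (fun x : nm_group => (x^-1)%g);
  nm_nilpotent : nilpotent_group nm_group;
  nm_lattice_subgroup : subgroup nm_lattice;
  nm_lattice_discrete : nm_lattice `<=` isolated nm_lattice;
  nm_lattice_cocompact : compact [set: coset_space nm_lattice];
  nm_filtrationP : filtration k nm_filtration;
  nm_filtration_closed : forall i, closed (nm_filtration i);
  nm_filtration_cocompact :
    forall i, compact [set: sub_coset_space (nm_filtration i) nm_lattice] }.
Arguments nm_lattice {R k} N _ : rename.
Arguments nm_filtration {R k} N i _ : rename.

Definition nm_space (R : realType) (k : nat) (N : nilmanifold R k)
  : topologicalType := coset_space (nm_lattice N).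

Definition nm_cubes (R : realType) (k : nat) (N : nilmanifold R k)
  : cubespace (nm_space N) := fun n =>
  [set coset_pi (nm_lattice N) \o (c : cube n -> nm_group N)
     | c in group_cubes (nm_filtration N) n].
Arguments nm_cubes {R k} N n _.

Definition polynomial_map (R : realType) (k : nat) (N : nilmanifold R k)
    (Z : zmodType) (g : Z -> nm_space N) : Prop :=
  nil_morphism (Dcubes 1 Z) (nm_cubes N) g.

(* The codomain R[i]^o is R[i] seen as a normed space over itself, which      *)
(* carries the usual topology of the complex numbers.                         *)
Record nilsequence (R : realType) (k : nat) (Z : zmodType) := Nilsequence {
  ns_nilmanifold : nilmanifold R k;
  ns_map : Z -> nm_space ns_nilmanifold;
  ns_fun : nm_space ns_nilmanifold -> R[i]^o;
  ns_polynomial : polynomial_map ns_map;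
  ns_continuous : continuous ns_fun;
  ns_bounded : forall p, `|ns_fun p| <= 1 }.

Definition complexity_le (R : realType) (E : CFR_enumeration R) (C : R)
    (k : nat) (Z : zmodType) (s : nilsequence R k Z) : Prop :=
  exists2 i : nat, (0 < i)%N /\ i%:R <= C &
    exists2 theta : CFR_rep E i -> nm_space (ns_nilmanifold s),
      nil_isomorphism (CFR_cubes E i) (nm_cubes (ns_nilmanifold s))
                      theta &
      forall x y : CFR_rep E i,
        `|ns_fun (theta x) - ns_fun (theta y)| <= (C * mdist x y)%:C.

Record projected_nilsequence (R : realType) (k : nat) (Z : finZmodType) :=
  ProjectedNilsequence {
    pns_group : finZmodType;
    pns_proj : {additive pns_group -> Z};
    pns_surj : forall x : Z, exists y, pns_proj y = x;
    pns_seq : nilsequence R k pns_group }.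

Definition pns_val (R : realType) (k : nat) (Z : finZmodType)
    (s : projected_nilsequence R k Z) (x : Z) : R[i] :=
  avg [set y | pns_proj s y == x]%SET
      (fun y => ns_fun (ns_map (pns_seq s) y)).

(* Main.v *)
(* Write phi for the projected nilsequence, tau : Z' -> Z for its projection,  *)
(* g for its polynomial map and F for its function. Since tau is surjective,  *)
(* <f, phi> = E_y f(tau y) conj(F(g y)) and f \o tau has the same Gowers norm *)
(* as f, so one may work on Z'. For all y, h_1, ..., h_(k+1) the points       *)
(* g(y + sum_(i | v_i = 0) h_i) form a (k+1)-cube of G/Gamma whose value at   *)
(* the top vertex is g(y), and a (k+1)-cube of a degree k nilmanifold is      *)
(* determined by its values off the top vertex. By compactness of the         *)
(* representative X_i this determination is uniform: some finite colouring of *)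
(* X_i is such that the colours of a (k+1)-cube off the top vertex determine  *)
(* its top value up to delta/(2C). Hence F(g y) is within delta/2 of a        *)
(* combination, with boundedly many coefficients of modulus at most 1, of     *)
(* products over v <> 1 of functions of g(y + sum_(i | v_i = 0) h_i) with     *)
(* values in {0, 1}. Against f each product contributes at most the           *)
(* U^(k+1)-norm of f by the Gowers-Cauchy-Schwarz inequality. The number of   *)
(* products depends only on i, delta and C, and there are finitely many       *)
(* i <= C.                                                                    *)

Require Import Defs.
From HB Require Import structures.
From mathcomp Require Import all_boot all_order all_algebra.
From mathcomp Require Import complex lra.
From mathcomp Require Import all_classical all_reals all_analysis.

Set Implicit Arguments.
Unset Strict Implicit.
Unset Printing Implicit Defensive.

Import Order.TTheory GRing.Theory Num.Theory.
Import numFieldNormedType.Exports.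

Local Open Scope classical_set_scope.
Local Open Scope ring_scope.

(** * Averages over finite types *)

(** A (k+1)-cube of a degree-k nilmanifold is determined by its values off the top vertex
    ([nm_cubes_top]). Indeed, the discrete derivative of a cube of the filtered group is a cube of
    the shifted filtration, so by induction on the dimension a cube with values in Gamma off the top
    vertex has its top value in Gamma ([group_cubes_top]). Compactness makes this determination
    uniform ([determined_uniform]): up to delta/2, the value of F at the top vertex is a function of
    finitely many colours at the other vertices ([compact_coloring]).

    Substituted into the correlation, this leaves a bounded number of averages of f against
    indicator functions at the other vertices, each at most the U^(k+1)-norm of f by
    Gowers-Cauchy-Schwarz ([cube_form_le]); this is [correlation_gowers]. Fibre averages disappear
    on lifting f along tau ([inner_pns_val], [gowers_form_surj]). The resulting bound sees the
    nilmanifold only through its representative, and complexity at most C allows finitely many of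
    these. *)

Section Mean.
Variable K : numClosedFieldType.

Definition mean (T : finType) (f : T -> K) : K := (\sum_x f x) / #|T|%:R.

Lemma eq_mean (T : finType) (f g : T -> K) : f =1 g -> mean f = mean g.
Proof. by move=> fg; rewrite /mean (eq_bigr g). Qed.

Lemma mean_pair (T U : finType) (f : T * U -> K) :
  mean f = mean (fun x => mean (fun y => f (x, y))).
Proof.
rewrite /mean -big_distrl /= pair_big /= card_prod natrM invfM.
rewrite [#|T|%:R^-1 * _]mulrC mulrA; congr (_ * _ * _).
by apply: eq_bigr => -[].
Qed.

Lemma exchange_mean (T U : finType) (f : T -> U -> K) :
  mean (fun x => mean (f x)) = mean (fun y => mean (f^~ y)).
Proof.
rewrite /mean -!big_distrl /= exchange_big /= -!mulrA; congr (_ * _).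
exact: mulrC.
Qed.

Lemma mean_mull (T : finType) (a : K) (f : T -> K) :
  mean (fun x => a * f x) = a * mean f.
Proof. by rewrite /mean -big_distrr /= mulrA. Qed.

Lemma mean_mulr (T : finType) (a : K) (f : T -> K) :
  mean (fun x => f x * a) = mean f * a.
Proof. by rewrite mulrC -mean_mull; apply: eq_mean => x; rewrite mulrC. Qed.

Lemma meanB (T : finType) (f g : T -> K) :
  mean (fun x => f x - g x) = mean f - mean g.
Proof. by rewrite /mean sumrB mulrBl. Qed.

Lemma mean_sum (T I : finType) (f : I -> T -> K) :
  mean (fun x => \sum_i f i x) = \sum_i mean (f i).
Proof. by rewrite /mean exchange_big /= big_distrl. Qed.

Lemma conj_mean (T : finType) (f : T -> K) : (mean f)^* = mean (fun x => (f x)^*).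
Proof. by rewrite /mean rmorphM rmorph_sum fmorphV rmorph_nat. Qed.

Lemma reindex_mean (T U : finType) (p : T -> U) (f : U -> K) :
  bijective p -> mean (fun x => f (p x)) = mean f.
Proof.
move=> p_bij; rewrite /mean (bij_eq_card p_bij).
by rewrite [in RHS](reindex p) //; apply: onW_bij.
Qed.

Lemma mean_cst (T : finType) (x0 : T) (a : K) : mean (fun _ : T => a) = a.
Proof.
rewrite /mean sumr_const -[a *+ _]mulr_natr mulfK // pnatr_eq0 -lt0n.
by apply/card_gt0P; exists x0.
Qed.

Lemma le_mean (T : finType) (f g : T -> K) :
  (forall x, f x <= g x) -> mean f <= mean g.
Proof.
by move=> fg; rewrite ler_wpM2r ?invr_ge0 ?ler0n //; apply: ler_sum.
Qed.

Lemma mean_ge0 (T : finType) (f : T -> K) :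
  (forall x, 0 <= f x) -> 0 <= mean f.
Proof. by move=> f0; rewrite divr_ge0 ?ler0n //; apply: sumr_ge0. Qed.

Lemma mean_le_cst (T : finType) (f : T -> K) (a : K) :
  0 <= a -> (forall x, f x <= a) -> mean f <= a.
Proof.
move=> a0 fa; have [x0|T0] := pickP (@predT T).
  by rewrite -[leRHS](mean_cst x0) le_mean.
by rewrite /mean big_pred0 ?mul0r // => x; have := T0 x.
Qed.

Lemma norm_mean (T : finType) (f : T -> K) :
  `|mean f| <= mean (fun x => `|f x|).
Proof.
rewrite /mean normrM normfV normr_nat ler_wpM2r ?invr_ge0 ?ler0n //.
exact: ler_norm_sum.
Qed.

(** The variance of f is nonnegative. *)
Lemma mean_sqr_le (T : finType) (f : T -> K) :
  (forall x, 0 <= f x) -> mean f ^+ 2 <= mean (fun x => f x ^+ 2).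
Proof.
move=> f0; have [x0|T0] := pickP (@predT T); last first.
  by rewrite /mean !big_pred0 ?mul0r ?expr0n // => x; have := T0 x.
have mr : mean f \is Num.real by rewrite ger0_real ?mean_ge0.
have: 0 <= mean (fun x => (f x - mean f) ^+ 2).
  by apply: mean_ge0 => x; rewrite real_exprn_even_ge0 // rpredB // ger0_real.
rewrite (@eq_mean _ _ (fun x => (f x ^+ 2 - f x * (mean f *+ 2)) - - mean f ^+ 2)).
  rewrite !meanB mean_mulr (mean_cst x0) opprK mulrnAr mulr2n opprD addrA subrK.
  by rewrite subr_ge0.
by move=> x; rewrite sqrrB opprK mulrnAr.
Qed.

Lemma mean_exp2_le (T : finType) (f : T -> K) (d : nat) :
  (forall x, 0 <= f x) -> mean f ^+ (2 ^ d) <= mean (fun x => f x ^+ (2 ^ d)).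
Proof.
move=> f0; elim: d => [|d IHd] //=.
rewrite expnSr exprM; apply: le_trans (_ : mean (fun x => f x ^+ (2 ^ d)) ^+ 2 <= _).
  apply: lerXn2r => //; rewrite nnegrE ?exprn_ge0 ?mean_ge0 // => x.
  exact: exprn_ge0.
apply: le_trans (mean_sqr_le _) _ => [x|]; first exact: exprn_ge0.
by apply: le_mean => x; rewrite exprM.
Qed.

End Mean.

(** * Splitting off the first coordinate of a vertex or of a tuple of directions *)

Section Fcons.
Variables (T : Type) (d : nat).

Definition fcons (a : T) (h : {ffun 'I_d -> T}) : {ffun 'I_d.+1 -> T} :=
  [ffun i => if unlift ord0 i is Some j then h j else a].

Lemma fcons0 a h : fcons a h ord0 = a.
Proof. by rewrite ffunE unlift_none. Qed.

Lemma fconsS a h i : fcons a h (lift ord0 i) = h i.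
Proof. by rewrite ffunE liftK. Qed.

Lemma fcons_eta (g : {ffun 'I_d.+1 -> T}) :
  fcons (g ord0) [ffun i => g (lift ord0 i)] = g.
Proof.
by apply/ffunP => i; rewrite ffunE; case: unliftP => [j|] ->; rewrite ?ffunE.
Qed.

Lemma fcons_bij : bijective (fun p => fcons p.1 p.2).
Proof.
exists (fun g : {ffun 'I_d.+1 -> T} =>
    (g ord0, [ffun i : 'I_d => g (lift ord0 i)])).
  case=> a h; rewrite /= fcons0; congr pair.
  by apply/ffunP => i; rewrite ffunE fconsS.
by move=> g; rewrite /= fcons_eta.
Qed.

End Fcons.

Lemma fcons_cst (T : Type) (d : nat) (a : T) :
  fcons a [ffun _ : 'I_d => a] = [ffun => a].
Proof. by apply/ffunP => i; rewrite !ffunE; case: unlift => // j; rewrite ffunE. Qed.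

(** * The Gowers-Cauchy-Schwarz inequality *)

Section Gowers.
Variables (K : numClosedFieldType) (Z : finZmodType).

Definition mderiv (t : Z) (f : Z -> K) (x : Z) : K := f x * (f (x + t))^*.

(** The 2^d-th power of the U^d-norm ([gowers_formE]), written as iterated derivatives so that
    inductions on d peel off one direction. *)
Fixpoint gowers_form (d : nat) (f : Z -> K) : K :=
  if d is d'.+1 then mean (fun t => gowers_form d' (mderiv t f)) else mean f.

Definition cube_shift d (h : {ffun 'I_d -> Z}) (v : cube d) : Z :=
  \sum_(i < d) h i *+ v i.

Lemma cube_shift_cons d (t : Z) (h : {ffun 'I_d -> Z}) (b : bool) (w : cube d) :
  cube_shift (fcons t h) (fcons b w) = t *+ b + cube_shift h w.
Proof.
rewrite /cube_shift big_ord_recl !fcons0; congr (_ + _).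
by apply: eq_bigr => i _; rewrite !fconsS.
Qed.

Lemma weight_cons d (b : bool) (w : cube d) :
  weight (fcons b w) = (b + weight w)%N.
Proof.
rewrite /weight -!sum1dep_card big_mkcond big_ord_recl fcons0 [in RHS]big_mkcond.
by congr (_ + _)%N; apply: eq_bigr => i _; rewrite fconsS.
Qed.

Lemma prod_cube_cons d (F : cube d.+1 -> K) :
  \prod_v F v = \prod_(w : cube d) (F (fcons false w) * F (fcons true w)).
Proof.
rewrite (reindex _ (onW_bij _ (@fcons_bij bool d))) /=.
rewrite -(pair_bigA _ (fun b w => F (fcons b w))) /= exchange_big /=.
by apply: eq_bigr => w _; rewrite big_bool mulrC.
Qed.

Lemma mean_ffun_cons d (F : {ffun 'I_d.+1 -> Z} -> K) :
  mean F = mean (fun t => mean (fun h => F (fcons t h))).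
Proof.
by rewrite -(reindex_mean _ (@fcons_bij Z d)) mean_pair.
Qed.

Lemma mean_ffun0 (F : {ffun 'I_0 -> Z} -> K) : mean F = F [ffun => 0].
Proof.
rewrite -[RHS](mean_cst ([ffun=> 0] : {ffun 'I_0 -> Z})).
apply: eq_mean => h; congr F.
by apply/ffunP => -[].
Qed.

Lemma prod_cube0 (F : cube 0 -> K) : \prod_v F v = F (cube0 0).
Proof.
by rewrite (big_pred1 (cube0 0)) // => v; rewrite /= ; apply/esym/eqP/ffunP => -[].
Qed.

Lemma cube_shift_dim0 (h : {ffun 'I_0 -> Z}) v : cube_shift h v = 0.
Proof. by rewrite /cube_shift big_ord0. Qed.

Lemma iter_conjM n (a b : K) :
  iter n Num.conj (a * b) = iter n Num.conj a * iter n Num.conj b.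
Proof. by elim: n => //= n ->; rewrite rmorphM. Qed.

Lemma gowers_formE d (f : Z -> K) :
  mean (fun x => mean (fun h : {ffun 'I_d -> Z} =>
    \prod_(v : cube d) iter (weight v) Num.conj (f (x + cube_shift h v))))
  = gowers_form d f.
Proof.
elim: d f => [|d IHd] f /=.
  apply: eq_mean => x; rewrite mean_ffun0 prod_cube0 cube_shift_dim0 addr0.
  suff -> : weight (cube0 0) = 0%N by [].
  by apply/eqP; rewrite cards_eq0; apply/eqP/setP => -[].
under eq_mean do rewrite mean_ffun_cons.
rewrite exchange_mean; apply: eq_mean => t; rewrite -IHd.
apply: eq_mean => x; apply: eq_mean => h; rewrite prod_cube_cons.
apply: eq_bigr => w _; rewrite !cube_shift_cons !weight_cons /= iter_conjM.
by rewrite mulr0n mulr1n add0r -iterSr /= addrA addrAC.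
Qed.

(** The Gowers inner product of a family indexed by vertices, with the conjugations absorbed into
    [B]. *)
Definition cube_form d (B : cube d -> Z -> K) : K :=
  mean (fun x => mean (fun h : {ffun 'I_d -> Z} =>
    \prod_(v : cube d) B v (x + cube_shift h v))).

Lemma sqr_norm_mean (P : Z -> K) :
  `|mean P| ^+ 2 = mean (fun t => mean (mderiv t P)).
Proof.
rewrite exchange_mean normCK conj_mean -mean_mulr; apply: eq_mean => x.
by rewrite -mean_mull -(reindex_mean _ (p := fun t => x + t)).
Qed.

(* The product over the vertices v with v 0 = true depends on x and t only     *)
(* through x + t, so the form is a mean over h of a product of two means;     *)
(* Cauchy-Schwarz in h removes the second one.                                *)
Lemma cube_form_sqr_le d (B : cube d.+1 -> Z -> K) :
  (forall v x, v != cube0 d.+1 -> `|B v x| <= 1) ->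
  `|cube_form B| ^+ 2 <=
    mean (fun t => cube_form (fun w => mderiv t (B (fcons false w)))).
Proof.
move=> B1.
pose P h x := \prod_(w : cube d) B (fcons false w) (x + cube_shift h w).
pose Q h x := \prod_(w : cube d) B (fcons true w) (x + cube_shift h w).
have -> : cube_form B = mean (fun h => mean (P h) * mean (Q h)).
  rewrite /cube_form exchange_mean mean_ffun_cons exchange_mean; apply: eq_mean => h.
  rewrite exchange_mean -mean_mulr; apply: eq_mean => x.
  rewrite -mean_mull -(reindex_mean _ (p := fun t => x + t)) //.
  apply: eq_mean => t; rewrite prod_cube_cons big_split /=; congr (_ * _).
    by apply: eq_bigr => w _; rewrite cube_shift_cons mulr0n add0r.
  by apply: eq_bigr => w _; rewrite cube_shift_cons mulr1n addrA.
have Q1 h : `|mean (Q h)| <= 1.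
  apply: le_trans (norm_mean _) _; apply: mean_le_cst => // x.
  rewrite normr_prod; apply: prodr_ile1 => w _; rewrite normr_ge0 B1 //.
  by apply: contra_eq_neq (fcons0 true w) => ->; rewrite ffunE.
have ge0 h : 0 <= `|mean (P h) * mean (Q h)| by [].
have -> : mean (fun t => cube_form (fun w => mderiv t (B (fcons false w)))) =
          mean (fun h => `|mean (P h)| ^+ 2).
  under [RHS]eq_mean do rewrite sqr_norm_mean.
  rewrite [RHS]exchange_mean; apply: eq_mean => t.
  rewrite [RHS]exchange_mean; apply: eq_mean => x; apply: eq_mean => h.
  rewrite /mderiv /P rmorph_prod -big_split; apply: eq_bigr => w _ /=.
  by rewrite addrAC.
apply: (@le_trans _ _ (mean (fun h => `|mean (P h) * mean (Q h)|) ^+ 2)).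
  by apply: lerXn2r; rewrite ?norm_mean // nnegrE mean_ge0.
apply: le_trans (mean_sqr_le ge0) _; apply: le_mean => h.
by rewrite normrM exprMn ler_piMr ?exprn_ge0 // exprn_ile1.
Qed.

Lemma norm_mderiv_le1 (f : Z -> K) t x :
  (forall x, `|f x| <= 1) -> `|mderiv t f x| <= 1.
Proof. by move=> f1; rewrite normrM norm_conjC mulr_ile1. Qed.

(** Each Cauchy-Schwarz step discards the functions on one facet and differentiates the others;
    after all directions only derivatives of the function at [cube0] remain. That function itself
    need not be bounded. *)
Lemma cube_form_le d (B : cube d.+1 -> Z -> K) :
  (forall v x, v != cube0 d.+1 -> `|B v x| <= 1) ->
  `|cube_form B| ^+ (2 ^ d.+1) <= gowers_form d.+1 (B (cube0 d.+1)).
Proof.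
elim: d B => [|d IHd] B B1.
  rewrite (le_trans (cube_form_sqr_le B1)) //; apply: le_mean => t.
  rewrite /cube_form le_eqVlt; apply/orP; left; apply/eqP; apply: eq_mean => x.
  by rewrite mean_ffun0 prod_cube0 cube_shift_dim0 addr0 fcons_cst.
pose D t := cube_form (fun w => mderiv t (B (fcons false w))).
have D0 : `|cube_form B| ^+ 2 <= mean (fun t => `|D t|).
  (* The mean of [D] equals its modulus, since it lies above the square of a modulus. *)
  apply: le_trans (norm_mean _); rewrite [leRHS]ger0_norm.
    exact: cube_form_sqr_le.
  by apply: le_trans (cube_form_sqr_le B1); rewrite exprn_ge0.
rewrite expnS exprM.
apply: (@le_trans _ _ (mean (fun t => `|D t|) ^+ (2 ^ d.+1))).
  by apply: lerXn2r; rewrite // nnegrE ?exprn_ge0 ?mean_ge0.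
apply: le_trans (mean_exp2_le _ _) _ => //; apply: le_mean => t.
rewrite -[cube0 d.+2]/[ffun => false] -fcons_cst; apply: IHd => v x vn0.
apply: norm_mderiv_le1 => y; apply: B1; apply: contra_neq vn0 => v0.
apply/ffunP => i; have /ffunP /(_ (lift ord0 i)) := v0.
by rewrite fconsS !ffunE.
Qed.

End Gowers.

(** * Averages and Gowers forms along a surjective homomorphism *)

Section Fibers.
Variables (K : numClosedFieldType) (Z' Z : finZmodType).
Variable tau : {additive Z' -> Z}.
Hypothesis tau_surj : forall x : Z, exists y, tau y = x.

(** The fibres are translates of one another. *)
Lemma card_fiber x :
  (#|Z'| = #|[set y | tau y == x]%SET| * #|Z|)%N.
Proof.
have fib z : #|[set y | tau y == z]%SET| = #|[set y | tau y == x]%SET|.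
  have [u tu] := tau_surj (z - x).
  rewrite -(card_imset [set y | tau y == x]%SET (addrI u)).
  apply: eq_card => y; rewrite !inE; apply/eqP/imsetP => [yz|[w]].
    by exists (y - u); rewrite ?inE ?subrKC // raddfB /= yz tu subKr.
  by rewrite !inE => /eqP wx ->; rewrite raddfD /= tu wx subrK.
rewrite -[LHS]sum1_card (partition_big tau predT) //=.
rewrite mulnC -sum_nat_const; apply: eq_bigr => z _.
by rewrite -(fib z) -sum1_card; apply: eq_bigl => y; rewrite inE.
Qed.

Lemma mean_fibers (F : Z' -> K) :
  mean F = mean (fun x =>
    (\sum_(y in [set y | tau y == x]%SET) F y) / #|[set y | tau y == x]%SET|%:R).
Proof.
have cst x : #|[set y | tau y == x]%SET| = #|[set y | tau y == 0]%SET|.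
  have Z0 : (0 < #|Z|)%N by apply/card_gt0P; exists 0.
  by apply/eqP; rewrite -(eqn_pmul2r Z0) -!card_fiber.
rewrite (eq_mean (fun x => congr1 (fun n => _ / n%:R) (cst x))) mean_mulr.
rewrite /mean {1}(card_fiber 0) natrM invfM mulrA mulrAC; congr (_ / _ / _).
rewrite (partition_big tau predT) //=.
by apply: eq_bigr => x _; apply: eq_bigl => y; rewrite inE.
Qed.

Lemma mean_surj (u : Z -> K) : mean (fun y => u (tau y)) = mean u.
Proof.
rewrite mean_fibers; apply: eq_mean => x.
rewrite (eq_bigr (fun=> u x)) => [|y]; last by rewrite inE => /eqP ->.
rewrite sumr_const -[_ *+ _]mulr_natr mulfK // pnatr_eq0 -lt0n.
have [y yx] := tau_surj x.
by apply/card_gt0P; exists y; rewrite inE yx.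
Qed.

Lemma gowers_form_surj d (f : Z -> K) :
  gowers_form d (fun y => f (tau y)) = gowers_form d f.
Proof.
elim: d f => [|d IHd] f /=; first exact: mean_surj.
rewrite -[RHS]mean_surj; apply: eq_mean => t; rewrite -IHd; congr gowers_form.
by apply/funext => y; rewrite /mderiv raddfD.
Qed.

End Fibers.

(** * Cubes of a filtered group *)

Section Subgroups.
Variable G : groupType.
Implicit Types (H S T : set G) (x y : G).

Lemma subgroupV H x : subgroup H -> H x -> H (x^-1)%g.
Proof. by case=> H1 HB Hx; rewrite -[_^-1%g]mul1g; apply: HB. Qed.

Lemma subgroupM H x y : subgroup H -> H x -> H y -> H (x * y)%g.
Proof.
by move=> HP Hx Hy; rewrite -[y]invgK; apply: HP.2 => //; apply: subgroupV.
Qed.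

Lemma smallest_subgroup S : subgroup (smallest (@subgroup G) S).
Proof.
split=> [A [[A1 _] _] //|x y Sx Sy A SA].
by case: (SA) => [[_ AB] _]; apply: AB; [apply: Sx | apply: Sy].
Qed.

(** Normalisation passes from generators to generated subgroups: first in s for a fixed generator t,
    then in t. *)
Lemma smallest_conjg S T :
  (forall t, T t -> T (t^-1)%g) ->
  (forall s t, S s -> T t -> smallest (@subgroup G) S (s ^ t)%g) ->
  forall s t, smallest (@subgroup G) S s -> smallest (@subgroup G) T t ->
  smallest (@subgroup G) S (s ^ t)%g.
Proof.
move=> TV ST.
have gST t : T t -> forall s, smallest (@subgroup G) S s ->
    smallest (@subgroup G) S (s ^ t)%g.
  move=> Tt s; set H := [set x | smallest (@subgroup G) S (x ^ t)%g].
  apply: (@smallest_sub _ _ _ H) => [|x Sx]; last exact: ST.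
  split=> [|x y Hx Hy]; rewrite /H /=.
    by rewrite conj1g; case: (smallest_subgroup S).
  rewrite conjMg conjVg; case: (smallest_subgroup S) => _; exact.
(* Imposing the condition on t and on its inverse makes [N] closed under division. *)
set N := [set t | forall s, smallest (@subgroup G) S s ->
  smallest (@subgroup G) S (s ^ t)%g /\ smallest (@subgroup G) S (s ^ t^-1)%g].
suff TN : smallest (@subgroup G) T `<=` N by move=> s t Ss /TN /(_ s Ss) [].
apply: smallest_sub => [|t Tt s Ss]; last by split; apply: gST => //; apply: TV.
split=> [s Ss|x y Nx Ny s Ss]; first by rewrite invg1 conjg1.
rewrite invgM invgK !conjgM; split.
  by case: (Nx s Ss) => /Ny [].
by case: (Ny s Ss) => /Nx [].
Qed.

End Subgroups.

Section Faces.
Variables (n : nat).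
Implicit Types (S T : {set 'I_n}) (a b v : cube n).

Lemma in_face S a v : (v \in face S a) = [forall i in S, v i == a i].
Proof. by rewrite inE. Qed.

Lemma face_eq S a v : v \in face S a -> face S a = face S v.
Proof.
rewrite in_face => /forall_inP va; apply/setP => w; rewrite !in_face.
by apply: eq_forallb_in => i iS; rewrite (eqP (va i iS)).
Qed.

Lemma faceI S T v : (face S v :&: face T v)%SET = face (S :|: T)%SET v.
Proof.
apply/setP => w; rewrite !finset.in_setI !in_face; apply/andP/forall_inP => [[]|ST].
  by move=> /forall_inP wS /forall_inP wT i; rewrite inE => /orP[/wS|/wT].
by split; apply/forall_inP => i iS; apply: ST; rewrite inE iS ?orbT.
Qed.

End Faces.

Section FaceCons.
Variable n : nat.

Definition codir_tail (S : {set 'I_n.+1}) : {set 'I_n} :=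
  [set j | lift ord0 j \in S]%SET.

Definition cube_tail (a : cube n.+1) : cube n := [ffun j => a (lift ord0 j)].

Lemma card_codir_tail (S : {set 'I_n.+1}) :
  #|S| = ((ord0 \in S) + #|codir_tail S|)%N.
Proof.
rewrite -!sum1_card big_mkcond big_ord_recl [in RHS]big_mkcond /=.
by congr (_ + _)%N; apply: eq_bigr => i _; rewrite inE.
Qed.

Lemma in_face_cons (S : {set 'I_n.+1}) (a : cube n.+1) (b : bool) (w : cube n) :
  (fcons b w \in face S a) =
  ((ord0 \in S) ==> (b == a ord0)) && (w \in face (codir_tail S) (cube_tail a)).
Proof.
rewrite !in_face; apply/forall_inP/andP => [H|[/implyP H0 /forall_inP H] i].
  split; first by apply/implyP => /H; rewrite fcons0.
  by apply/forall_inP => i; rewrite inE => /H; rewrite fconsS ffunE.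
case: (unliftP ord0 i) => [j|] -> iS; last by rewrite fcons0 H0.
by have := H j; rewrite inE fconsS ffunE; apply.
Qed.

End FaceCons.

Section GroupCubes.
Variable G : groupType.

(** Unlike [filtration], this notion survives the shift of indices, where G_0 is no longer the whole
    group. *)
Record prefiltration (Gs : nat -> set G) : Prop := Prefiltration {
  prefiltration_subgroup : forall i, subgroup (Gs i);
  prefiltration_le : forall i, Gs i.+1 `<=` Gs i;
  prefiltration_commg :
    forall i j x y, Gs i x -> Gs j y -> Gs (i + j)%N [~ x, y]%g }.

Lemma prefiltration_leq Gs i j :
  prefiltration Gs -> (i <= j)%N -> Gs j `<=` Gs i.
Proof.
move=> GsP /subnK <-; elim: (j - i)%N => //= m IHm x /prefiltration_le; auto.
Qed.

Lemma prefiltration_shift Gs :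
  prefiltration Gs -> prefiltration (fun i => Gs i.+1).
Proof.
move=> GsP; split=> [i|i|i j x y Gx Gy].
- exact: prefiltration_subgroup.
- exact: prefiltration_le.
- by apply: prefiltration_le => //; rewrite -addSn -addnS; apply: prefiltration_commg.
Qed.

Lemma group_cubes_subgroup (Gs : nat -> set G) n : subgroup (group_cubes Gs n).
Proof. exact: smallest_subgroup. Qed.

Lemma group_cubes_face (Gs : nat -> set G) n (S : {set 'I_n}) a g :
  Gs #|S| g -> group_cubes Gs n (face_elt (face S a) g).
Proof. by move=> Gg; apply: sub_gen_smallest; exists S, a, g. Qed.

Lemma group_cubes_val Gs n c v :
  prefiltration Gs -> group_cubes Gs n c -> Gs 0%N (c v).
Proof.
move=> GsP; have [G1 GB] := prefiltration_subgroup GsP 0.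
apply: (@smallest_sub _ _ _ [set c : {ffun cube n -> G} | Gs 0%N (c v)]).
  by split=> [|x y Gx Gy]; rewrite /= !ffunE //; apply: GB.
move=> _ [S [b [g [Gg ->]]]]; rewrite /= ffunE; case: ifP => // _.
exact: prefiltration_leq Gg.
Qed.

Lemma face_elt_commg n (S T : {set 'I_n}) a b (g h : G) :
  [~ face_elt (face S a) g, face_elt (face T b) h]%g = 1%g \/
  exists v, [~ face_elt (face S a) g, face_elt (face T b) h]%g =
            face_elt (face (S :|: T)%SET v) [~ g, h]%g.
Proof.
have E : [~ face_elt (face S a) g, face_elt (face T b) h]%g =
    face_elt (face S a :&: face T b)%SET [~ g, h]%g.
  apply/ffunP => v; rewrite !ffunE finset.in_setI.
  case: (v \in face S a); case: (v \in face T b)  => //=;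
    by rewrite ?mulg1 ?mul1g ?invg1 ?mul1g ?mulVg.
have [v|ST0] := pickP (mem (face S a :&: face T b)%SET).
  rewrite /= finset.in_setI => /andP[vS vT]; right; exists v.
  by rewrite E (face_eq vS) (face_eq vT) faceI.
by left; rewrite E; apply/ffunP => v; rewrite !ffunE; have /= -> := ST0 v.
Qed.

(** On generators, c ^ d = c * [c, d], and the commutator is supported on an intersection of faces,
    of codimension at most the sum of the two, with value deep enough in the filtration. *)
Lemma group_cubes_conjg Gs n c d : prefiltration Gs ->
  group_cubes (fun i => Gs i.+1) n c -> group_cubes Gs n d ->
  group_cubes (fun i => Gs i.+1) n (c ^ d)%g.
Proof.
move=> GsP; move: c d; apply: smallest_conjg.
  move=> _ [S [b [g [Gg ->]]]]; exists S, b, g^-1%g; split.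
    by apply: subgroupV => //; apply: prefiltration_subgroup.
  by apply/ffunP => v; rewrite !ffunE; case: ifP; rewrite ?invg1.
move=> _ _ [S [a [g [Gg ->]]]] [T [b [h [Gh ->]]]].
rewrite -[(_ ^ _)%g](mulVKg (face_elt (face S a) g)) -/(commg _ _).
apply: (subgroupM (group_cubes_subgroup (fun i => Gs i.+1) n)).
  exact: (@group_cubes_face (fun i => Gs i.+1)).
have [->|[v ->]] := face_elt_commg S T a b g h.
  by case: (group_cubes_subgroup (fun i => Gs i.+1) n).
apply: (@group_cubes_face (fun i => Gs i.+1)).
apply: (@prefiltration_leq _ _ (#|S|.+1 + #|T|)) => //.
  by rewrite addSn ltnS cardsU leq_subr.
exact: prefiltration_commg.
Qed.

Definition slice n (b : bool) (c : {ffun cube n.+1 -> G}) : {ffun cube n -> G} :=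
  [ffun w => c (fcons b w)].

Lemma sliceB n b (c d : {ffun cube n.+1 -> G}) :
  slice b (c / d)%g = (slice b c / slice b d)%g.
Proof. by apply/ffunP => v; rewrite !ffunE. Qed.

Lemma slice_face_elt n b (S : {set 'I_n.+1}) a g :
  slice b (face_elt (face S a) g) =
  if (ord0 \in S) ==> (b == a ord0)
  then face_elt (face (codir_tail S) (cube_tail a)) g else 1%g.
Proof.
apply/ffunP => w; rewrite !ffunE in_face_cons.
by case: (_ ==> _); rewrite ffunE.
Qed.

(** A generator whose face fixes the first coordinate lies in one slice, where its codimension drops
    by one: hence the shift. The other generators have trivial derivative. *)
Lemma group_cubes_slice Gs n (c : {ffun cube n.+1 -> G}) : prefiltration Gs ->
  group_cubes Gs n.+1 c ->
  group_cubes Gs n (slice false c) /\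
  group_cubes (fun i => Gs i.+1) n ((slice false c)^-1 * slice true c)%g.
Proof.
move=> GsP; move: c; pose H := [set c | group_cubes Gs n (slice false c) /\
  group_cubes (fun i => Gs i.+1) n ((slice false c)^-1 * slice true c)%g].
rewrite -[forall c, _]/(group_cubes Gs n.+1 `<=` H).
have gs0 := group_cubes_subgroup Gs n.
have gs1 := group_cubes_subgroup (fun i => Gs i.+1) n.
apply: smallest_sub => [|_ [S [a [g [Gg ->]]]]].
  split=> [|x y [x0 x1] [y0 y1]].
    have s1 b : slice b 1%g = 1%g by apply/ffunP => v; rewrite !ffunE.
    by split; rewrite !s1 ?invg1 ?mulg1; [case: gs0 | case: gs1].
  split; rewrite !sliceB; first by case: gs0 => _; apply.
  set X := slice false x; set Y := slice false y.
  set X' := slice true x; set Y' := slice true y.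
  (* The derivative of a quotient is a conjugate of the quotient of the derivatives, whence the need
     for [group_cubes_conjg]. *)
  have -> : ((X / Y)^-1 * (X' / Y') =
      ((X^-1 * X') * (Y^-1 * Y')^-1) ^ Y^-1)%g.
    by rewrite conjgE invgK !invgM !invgK !mulgA mulgK.
  apply: group_cubes_conjg => //; first by case: gs1 => _; apply.
  exact: (subgroupV gs0).
rewrite /H /= !slice_face_elt; have := card_codir_tail S.
case: (ord0 \in S) => /= cardS.
  have Gt : Gs #|codir_tail S|.+1 g by rewrite -add1n -cardS.
  case: (a ord0) => /=; split.
  - by case: gs0.
  - by rewrite invg1 mul1g; apply: (@group_cubes_face (fun i => Gs i.+1)).
  - by apply: group_cubes_face; apply: prefiltration_le.
  - rewrite mulg1; apply: (subgroupV gs1).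
    exact: (@group_cubes_face (fun i => Gs i.+1)).
rewrite add0n in cardS; split; first by apply: group_cubes_face; rewrite -cardS.
by rewrite mulVg; case: gs1.
Qed.

(* The discrete derivative of c in the first direction is a cube of dimension *)
(* one less for the shifted filtration.                                       *)
Lemma group_cubes_top Gs n (Gamma : set G) (c : {ffun cube n -> G}) :
  prefiltration Gs -> Gs n = [set 1%g] -> subgroup Gamma ->
  group_cubes Gs n c -> (forall v, v != cube1 n -> Gamma (c v)) ->
  Gamma (c (cube1 n)).
Proof.
move=> + + GammaP; elim: n Gs c => [|n IHn] Gs c GsP Gs1 Gc cG.
  have := group_cubes_val (cube1 0) GsP Gc; rewrite Gs1 => ->.
  by case: GammaP.
have [_ Gd] := group_cubes_slice GsP Gc.
have c0 w : Gamma (c (fcons false w)).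
  by apply: cG; apply: contra_eq_neq (fcons0 false w) => ->; rewrite ffunE.
have : Gamma (((slice false c)^-1 * slice true c)%g (cube1 n)).
  apply: (IHn (fun i => Gs i.+1)) => //; first exact: prefiltration_shift.
  move=> v vn1; rewrite !ffunE; apply: subgroupM => //; first exact: subgroupV.
  apply: cG; apply: contra_neq vn1 => v1; apply/ffunP => i.
  by have /ffunP /(_ (lift ord0 i)) := v1; rewrite fconsS !ffunE.
rewrite !ffunE => /(subgroupM GammaP (c0 (cube1 n))).
by rewrite mulVKg -[cube1 n]/[ffun => true] fcons_cst.
Qed.

End GroupCubes.

Lemma coset_piP (G : topologicalGroupType) (Gamma : set G) (x y : G) :
  subgroup Gamma ->
  coset_pi Gamma x = coset_pi Gamma y <-> Gamma (x^-1 * y)%g.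
Proof.
have piE z : coset_pi Gamma z = classes_pi (coset_rel Gamma) z.
  by rewrite /coset_pi unlock.
move=> GammaP; rewrite !piE; split=> [/(congr1 (@proj1_sig _ _))|xy].
  have : coset_rel Gamma y y by rewrite /coset_rel mulVg; case: GammaP.
  by move=> /[swap] /= <-.
apply: eq_exist; apply/funext => z; apply/propext; split.
  move=> xz; rewrite /coset_rel -(mulVKg x z) mulgA.
  by apply: subgroupM => //; have := subgroupV GammaP xy; rewrite invgM invgK.
by move=> yz; rewrite /coset_rel -(mulVKg y z) mulgA; apply: subgroupM.
Qed.

(** Lift the cubes to d and d' in G: then d^-1 d' is a cube with values in Gamma off the top vertex,
    and G_(k+1) is trivial. *)
Lemma nm_cubes_top (R : realType) (k : nat) (N : nilmanifold R k)
    (c c' : cube k.+1 -> nm_space N) :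
  nm_cubes N k.+1 c -> nm_cubes N k.+1 c' ->
  (forall v, v != cube1 k.+1 -> c v = c' v) -> c (cube1 k.+1) = c' (cube1 k.+1).
Proof.
case=> d Gd <- [d' Gd' <-] dd'; have latP := nm_lattice_subgroup N.
have filP : prefiltration (nm_filtration N).
  by case: (nm_filtrationP N) => *; split.
apply/(coset_piP _ _ latP).
have := @group_cubes_top _ (nm_filtration N) k.+1 (nm_lattice N) (d^-1 * d')%g.
rewrite !ffunE; apply=> //; first by case: (nm_filtrationP N).
  apply: (subgroupM (group_cubes_subgroup _ _)) => //.
  exact: (subgroupV (group_cubes_subgroup _ _)).
by move=> v /dd' /(coset_piP _ _ latP); rewrite !ffunE.
Qed.

(** * Uniform determination on a compact metric space *)

Section CompactMetric.
Variables (R : realType) (X : metricType R).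

Lemma mdist_continuous : continuous (fun p : X * X => mdist p.1 p.2 : R).
Proof.
move=> [x y]; apply/cvgrPdist_lt => e e0 /=.
have e2 : 0 < e / 2 by rewrite divr_gt0.
exists (ball x (e / 2), ball y (e / 2)).
  by split; apply: nbhsx_ballx.
move=> [x' y'] /= []; rewrite !ballEmdist /= => xx' yy'.
have := metric_triangle x x' y; have := metric_triangle x' y' y.
have := metric_triangle x' x y'; have := metric_triangle x y y'.
rewrite (metric_sym x' x) (metric_sym y' y) ltr_norml.
lra.
Qed.

(** The colour of a point is the index of the first ball of radius e/2, in a finite cover, that
    contains it. *)
Lemma compact_coloring (e : R) : compact [set: X] -> 0 < e ->
  exists (m : nat) (color : X -> 'I_m.+1),
    forall x y, color x = color y -> mdist x y < e.
Proof.
move=> /compact_near_coveringP Xc e0; have e2 : 0 < e / 2 by rewrite divr_gt0.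
pose near_to (y x : X) : bool := `[< ball x (e / 2) y >].
(* Finite lists of centres, directed by inclusion: near-covering compactness then yields one list
   that serves all points. *)
pose F := filter_from [set: seq X] (fun s0 => [set s : seq X | {subset s0 <= s}]).
have FF : Filter F.
  apply: filter_from_filter; first by exists [::].
  move=> s1 s2 _ _; exists (s1 ++ s2) => // s s12; split=> x xs; apply: s12;
    by rewrite mem_cat xs ?orbT.
have [|s0 _ /(_ s0 (fun _ => id)) hasX] := Xc _ F (fun s y => has (near_to y) s) FF.
  move=> x _; exists (ball x (e / 2), [set s : seq X | {subset [:: x] <= s}]).
    by split; [apply: nbhsx_ballx | exists [:: x]].
  move=> [y s] /= [xy xs]; apply/hasP; exists x; first by apply: xs; rewrite inE.
  by apply/asboolP.
exists (size s0), (fun y => inord (find (near_to y) s0)).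
have nth_near y : ball (nth y s0 (find (near_to y) s0)) (e / 2) y.
  by apply/asboolP; apply: (nth_find y (hasX y I)).
move=> x y /(congr1 val); rewrite /= !inordK ?ltnS ?find_size // => xy.
have sy : (find (near_to y) s0 < size s0)%N by rewrite -has_find hasX.
have := nth_near y; have := nth_near x.
rewrite xy (set_nth_default y x sy) !ballEmdist /= => zx zy.
rewrite [e]splitr.
apply: le_lt_trans (metric_triangle x (nth y s0 (find (near_to y) s0)) y) _.
by rewrite ltrD // metric_sym.
Qed.

Variables (T : choiceType) (i0 : T) (C : set (T -> X)).
Hypotheses (XC : compact [set: X]) (Ccl : closed (C : set {ptws T -> X})).
Hypothesis C_det :
  forall c c', C c -> C c' -> (forall i, i != i0 -> c i = c' i) -> c i0 = c' i0.

(** By compactness of the space of pairs of maps, it suffices to find a suitable r near each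
    pair. *)
Lemma determined_uniform (eta : R) : 0 < eta ->
  exists2 r : R, 0 < r & forall c c', C c -> C c' ->
    (forall i, i != i0 -> mdist (c i) (c' i) < r) -> mdist (c i0) (c' i0) < eta.
Proof.
move=> eta0; pose Y := ({ptws T -> X} * {ptws T -> X})%type.
have dist_cont i : continuous (fun p : Y => mdist (p.1 i) (p.2 i) : R).
  move=> p; apply: (@continuous_comp Y (X * X)%type R
    (fun p => (p.1 i, p.2 i)) (fun q => mdist q.1 q.2)).
    apply: cvg_pair => /=.
      apply: (@continuous_comp Y {ptws T -> X} X fst (@proj T (fun=> X) i)).
        exact: cvg_fst.
      exact: proj_continuous.
    apply: (@continuous_comp Y {ptws T -> X} X snd (@proj T (fun=> X) i)).
      exact: cvg_snd.
    exact: proj_continuous.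
  exact: mdist_continuous.
have Yc : compact [set: Y].
  have pc : compact [set: {ptws T -> X}].
    have := @tychonoff T (fun=> X) (fun=> setT) (fun=> XC).
    by congr compact; apply/seteqP; split.
  by rewrite -setXTT; apply: compact_setX.
pose P (r : R) (p : Y) := C p.1 -> C p.2 ->
  (forall i, i != i0 -> mdist (p.1 i) (p.2 i) < r) -> mdist (p.1 i0) (p.2 i0) < eta.
have near_pos : \forall r \near (0 : R)^'+, 0 < r by exact: nbhs_right_gt.
have : \forall r \near (0 : R)^'+, [set: Y] `<=` P r.
  apply: ((compact_near_coveringP _).1 Yc) => p _.
  have nearP U a : nbhs p U -> 0 < a -> (forall q r, U q -> r < a -> P r q) ->
      \forall q \near p & r \near (0 : R)^'+, P r q.
    move=> Up a0 UP; exists (U, [set r | r < a]) => [|[q r] [/= Uq ra]].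
      by split=> //; apply: nbhs_right_lt.
    exact: UP.
  have nbhsC (f : {ptws T -> X}) : ~ C f -> nbhs f (~` C).
    by move=> nCf; apply: open_nbhs_nbhs; split=> //; apply: closed_openC.
  have [C1|/nbhsC nC1] := pselect (C p.1); last first.
    by apply: (nearP _ 1 (cvg_fst nC1)) => // q r nCq _ /nCq.
  have [C2|/nbhsC nC2] := pselect (C p.2); last first.
    by apply: (nearP _ 1 (cvg_snd nC2)) => // q r nCq _ _ /nCq.
  have [lt_eta|ge_eta] := ltP (mdist (p.1 i0) (p.2 i0)) eta.
    apply: (nearP _ 1 (cvgr_lt _ (dist_cont i0 p) _ lt_eta)) => //.
    by move=> q r lt_q _ _ _ _.
  (* Both maps are in C and differ at [i0], so they differ at another index; half that distance is a
     radius that excludes all nearby pairs. *)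
  have [i [i_neq d_gt0]] : exists i, i != i0 /\ 0 < mdist (p.1 i) (p.2 i).
    apply: contrapT => noi; move: ge_eta.
    rewrite (C_det C1 C2) ?mdistxx ?leNgt ?eta0 //.
    move=> i i_neq; apply: contrapT => /eqP; rewrite -mdist_gt0 => d_gt0.
    by apply: noi; exists i.
  have d2 : mdist (p.1 i) (p.2 i) / 2 < mdist (p.1 i) (p.2 i).
    by rewrite ltr_pdivrMr // ltr_pMr // ltr1n.
  apply: (nearP _ (mdist (p.1 i) (p.2 i) / 2)
    (cvgr_gt _ (dist_cont i p) _ d2)) => [|q r lt_q r_lt _ _].
    by rewrite divr_gt0.
  by move=> /(_ i i_neq) /(lt_trans lt_q) /(lt_trans r_lt); rewrite ltxx.
move=> /(filterI near_pos) /filter_ex[r [r0 rP]]; exists r => // c c' Cc Cc'.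
exact: (rP (c, c') I Cc Cc').
Qed.

End CompactMetric.

(** * Correlation with nilsequences *)

Local Open Scope complex_scope.

(** Exchanges the top vertex, where nilmanifold cubes are determined, with [cube0], the vertex kept
    by [cube_form_le]. *)
Definition cubeN n (v : cube n) : cube n := [ffun i => ~~ v i].

Lemma cubeNK n : involutive (@cubeN n).
Proof. by move=> v; apply/ffunP => i; rewrite !ffunE negbK. Qed.

Lemma cubeN0 n : cubeN (cube0 n) = cube1 n.
Proof. by apply/ffunP => i; rewrite !ffunE. Qed.

Lemma cubeN1 n : cubeN (cube1 n) = cube0 n.
Proof. by rewrite -cubeN0 cubeNK. Qed.

Lemma cube_shift_cube0 (Z : finZmodType) n (h : {ffun 'I_n -> Z}) :
  cube_shift h (cube0 n) = 0.
Proof. by rewrite /cube_shift big1 // => i _; rewrite ffunE. Qed.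

(** The map is y on the whole cube plus, for each i, h_i on the facet v_i = 0. *)
Lemma Dcubes1_shift (Z : finZmodType) n (y : Z) (h : {ffun 'I_n -> Z}) :
  Dcubes 1 Z n (fun v => y + cube_shift h (cubeN v)).
Proof.
move=> H [[H0 HB] HF].
have HD a b : H a -> H b -> H (a + b).
  by move=> Ha Hb; rewrite -[b]opprK -[- b]sub0r; apply/HB/HB.
have Hface (S : {set 'I_n}) b a : (#|S| <= 1)%N -> H (face_fun (face S b) a).
  by move=> S1; apply: HF; exists S, b, a.
suff -> : (fun v => y + cube_shift h (cubeN v)) =
    face_fun (face finset.set0 (cube0 n)) y +
    \sum_(i < n) face_fun (face [set i]%SET (cube0 n)) (h i).
  apply: (HD); first by apply: (Hface); rewrite cards0.
  by apply: (big_ind H H0 HD) => i _; apply: Hface; rewrite cards1.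
apply/funext => v; rewrite fctE fct_sumE; congr (_ + _).
  rewrite /face_fun in_face ifT //; by apply/forall_inP => i; rewrite inE.
apply: eq_bigr => i _; rewrite /face_fun in_face ffunE.
have -> : [forall j in [set i]%SET, v j == cube0 n j] = ~~ v i.
  apply/forall_inP/idP => [/(_ i)|vi j].
    by rewrite inE eqxx ffunE => /(_ isT); case: (v i).
  by rewrite inE => /eqP ->; rewrite ffunE (negbTE vi).
by case: (v i).
Qed.

Lemma correlation_gowers (R : realType) (X : metricType R) (CX : cubespace X)
    (k : nat) (delta C : R) :
  compact [set: X] -> closed (CX k.+1 : set {ptws cube k.+1 -> X}) ->
  (forall c c', CX k.+1 c -> CX k.+1 c' ->
     (forall v, v != cube1 k.+1 -> c v = c' v) ->
     c (cube1 k.+1) = c' (cube1 k.+1)) ->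
  0 < delta -> 0 < C ->
  exists2 eps : R, 0 < eps &
    forall (Z : finZmodType) (f : Z -> R[i]) (p : Z -> X) (F : X -> R[i]),
    (forall x, `|f x| <= 1) -> (forall x, `|F x| <= 1) ->
    (forall x y, `|F x - F y| <= (C * mdist x y)%:C) ->
    (forall y h, CX k.+1 (fun v => p (y + cube_shift h (cubeN v)))) ->
    delta%:C <= `|mean (fun y => f y * (F (p y))^*)| ->
    eps%:C <= (2 ^ k.+1).-root (gowers_form k.+1 f).
Proof.
move=> Xc Ccl Cdet delta0 C0; set top := cube1 k.+1.
have eta0 : 0 < delta / (2 * C) by rewrite divr_gt0 ?mulr_gt0.
have [r r0 near_det] := determined_uniform Xc Ccl Cdet eta0.
have [m [color colorP]] := compact_coloring Xc r0.
(* The colour at the top vertex is made constant, so that the coefficient of a  *)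
(* cube does not depend on its top value.                                      *)
pose col (v : cube k.+1) x := if v == top then ord0 else color x.
pose Q (c : cube k.+1 -> X) : {ffun cube k.+1 -> 'I_m.+1} :=
  [ffun v => col v (c v)].
pose N := #|{ffun cube k.+1 -> 'I_m.+1}|.
have N0 : (0 < N)%N by apply/card_gt0P; exists [ffun=> ord0].
(* Half of delta pays for the approximation of F; the rest is shared among the [N] colour
   patterns. *)
exists (delta / 2 / N%:R); first by rewrite !divr_gt0 ?ltr0n.
move=> Z f p F f1 F1 FL pC; set u := _.-root _.
(* The value of F at the top of some chosen cube with colour pattern q, and 0 if no cube has this
   pattern. *)
pose a (q : {ffun cube k.+1 -> 'I_m.+1}) : R[i] :=
  if pselect (exists c, CX k.+1 c /\ Q c = q) is left cP then F (sval (cid cP) top)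
  else 0.
have a1 q : `|a q| <= 1.
  by rewrite /a; case: pselect => // _; rewrite normr0.
have aQ c : CX k.+1 c -> `|F (c top) - a (Q c)| <= (delta / 2)%:C.
  move=> Cc; rewrite /a; case: pselect => [cP|[]]; last by exists c.
  case: (cid cP) => c' /= [Cc' QQ]; apply: le_trans (FL _ _) _; rewrite lecR.
  have : mdist (c top) (c' top) < delta / (2 * C).
    apply: near_det => // v v_top; apply: colorP; have /ffunP/(_ v) := QQ.
    by rewrite !ffunE /col (negbTE v_top).
  rewrite invfM mulrA ltr_pdivlMr // mulrC => /ltW //.
pose line (y : Z) (h : {ffun 'I_k.+1 -> Z}) v := p (y + cube_shift h (cubeN v)).
pose D := mean (fun y => mean (fun h => f y * (a (Q (line y h)))^*)).
have D_near : `|mean (fun y => f y * (F (p y))^*) - D| <= (delta / 2)%:C.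
  have d0 : 0 <= (delta / 2)%:C by rewrite lecR ltW // divr_gt0.
  rewrite /D -meanB; apply: le_trans (norm_mean _) _; apply: mean_le_cst => // y.
  rewrite -[X in X - _](mean_cst ([ffun=> 0] : {ffun 'I_k.+1 -> Z})) -meanB.
  apply: le_trans (norm_mean _) _; apply: mean_le_cst => // h.
  rewrite -mulrBr -rmorphB normrM norm_conjC.
  apply: le_trans (_ : 1 * `|F (p y) - a (Q (line y h))| <= _).
    by apply: ler_wpM2r.
  have /aQ : CX k.+1 (line y h) by exact: pC.
  by rewrite mul1r /line cubeN1 cube_shift_cube0 addr0.
(* f sits at [cube0]; the other vertices carry the indicators that the colours agree with q. *)
pose B (q : {ffun cube k.+1 -> 'I_m.+1}) (w : cube k.+1) x : R[i] :=
  if w == cube0 _ then f x else (col (cubeN w) (p x) == q (cubeN w))%:R.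
have B_le q : `|cube_form (B q)| <= u.
  rewrite -[leLHS](@exprCK _ (2 ^ k.+1)) ?expn_gt0 // ler_rootCl ?expn_gt0 //.
    apply: le_trans (cube_form_le _) _ => [w x /negbTE w0|].
      by rewrite /B w0; case: eqP; rewrite ?normr1 ?normr0.
    by rewrite /B eqxx.
  by rewrite nnegrE exprn_ge0.
(* For given y and h only the pattern of the cube itself survives; any other q with q top = [ord0]
   disagrees with it at a vertex other than the top, where an indicator vanishes. *)
have DE : D = \sum_q ((a q)^* * (q top == ord0)%:R) * cube_form (B q).
  under eq_bigr do rewrite -mean_mull.
  rewrite -mean_sum; apply: eq_mean => y.
  under eq_bigr do rewrite -mean_mull.
  rewrite -mean_sum; apply: eq_mean => h.
  rewrite (bigD1 (Q (line y h))) //= [X in _ + X]big1 ?addr0 => [|q qQ].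
    rewrite ffunE /col eqxx mulr1 mulrC; congr (_ * _).
    rewrite (bigD1 (cube0 _)) //= /B eqxx cube_shift_cube0 addr0.
    rewrite big1 ?mulr1 // => w /negbTE w0.
    by rewrite w0 ffunE /line cubeNK eqxx.
  have [q0|] := eqVneq (q top) ord0; last by rewrite mulr0 mul0r.
  have [v qv] : exists v, col v (line y h v) != q v.
    apply/existsP; apply: contra_neqT qQ; rewrite negb_exists => /forallP QE.
    by apply/ffunP => v; rewrite ffunE; apply/esym/eqP; rewrite -[_ == _]negbK QE.
  rewrite (bigD1 (cubeN v)) //= /B ifF ?cubeNK; last first.
    apply: contra_neqF qv => /eqP v0; rewrite -[v]cubeNK v0 cubeN0.
    by rewrite /col eqxx q0.
  by rewrite (negbTE qv) mul0r mulr0.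
have D_le : `|D| <= N%:R * u.
  rewrite DE; apply: le_trans (ler_norm_sum _ _ _) _.
  rewrite mulr_natl -sumr_const; apply: ler_sum => q _.
  rewrite normrM [X in X * _]normrM norm_conjC.
  apply: le_trans (_ : 1 * `|cube_form (B q)| <= _); last by rewrite mul1r.
  by apply: ler_wpM2r => //; rewrite mulr_ile1 //; case: eqP; rewrite ?normr1 ?normr0.
move=> delta_le; rewrite rmorphM fmorphV rmorph_nat ler_pdivrMr ?ltr0n //.
rewrite [leRHS]mulrC; apply: le_trans D_le.
have -> : delta / 2 = delta - delta / 2 by rewrite [X in X - _]splitr addrK.
rewrite rmorphB lerBlDr; apply: le_trans delta_le _.
rewrite -[X in `|X|](subrK D) addrC; apply: le_trans (ler_normD _ _) _.
by rewrite lerD2l.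
Qed.

Lemma gowers_normE (R : realType) (Z : finZmodType) d (f : Z -> R[i]) :
  gowers_norm d f = (2 ^ d).-root (gowers_form d f).
Proof.
rewrite /gowers_norm -gowers_formE; congr (_.-root _).
rewrite -[RHS](mean_pair (fun xh => \prod_(v : cube d)
  iter (weight v) Num.conj (f (xh.1 + cube_shift xh.2 v)))).
by rewrite /avg cardsT /mean; congr (_ / _); apply: eq_bigl => x; rewrite inE.
Qed.

Lemma inner_pns_val (R : realType) (k : nat) (Z : finZmodType)
    (s : projected_nilsequence R k Z) (f : Z -> R[i]) :
  inner f (pns_val s) = mean (fun y => f (pns_proj s y) *
    (ns_fun (ns_map (pns_seq s) y) : R[i])^*).
Proof.
rewrite (mean_fibers (@pns_surj _ _ _ s)) /inner /avg cardsT /mean.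
congr (_ / _); apply: eq_big => [x|x _]; first by rewrite inE.
rewrite /pns_val /avg rmorphM rmorph_sum fmorphV rmorph_nat mulrA.
congr (_ / _); rewrite big_distrr /=; apply: eq_bigr => y.
by rewrite inE => /eqP ->.
Qed.

Definition correlation_bound (R : realType) (E : CFR_enumeration R) (k : nat)
    (delta C eps : R) (i : nat) : Prop :=
  forall (Z : finZmodType) (f : Z -> R[i]) (phi : projected_nilsequence R k Z)
    (theta : CFR_rep E i -> nm_space (ns_nilmanifold (pns_seq phi))),
  (forall x, `|f x| <= 1) ->
  nil_isomorphism (CFR_cubes E i) (nm_cubes (ns_nilmanifold (pns_seq phi))) theta ->
  (forall x y, `|ns_fun (theta x) - ns_fun (theta y)| <= (C * mdist x y)%:C) ->
  delta%:C <= `|inner f (pns_val phi)| -> eps%:C <= gowers_norm k.+1 f.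

(** Pulling the polynomial map back along theta moves everything to the fixed representative, so its
    compactness gives one eps for all nilmanifolds isomorphic to it. *)
Lemma exists_correlation_bound (R : realType) (E : CFR_enumeration R) (k i : nat)
    (delta C : R) : (0 < i)%N -> 0 < delta -> 0 < C ->
  exists2 eps : R, 0 < eps & correlation_bound E k delta C eps i.
Proof.
move=> i0 delta0 C0; pose X := CFR_rep E i; pose CX := @CFR_cubes R E i.
have [k' [Xnil _ _]] := CFR_repP E i0.
have [det|ndet] := pselect (forall c c', CX k.+1 c -> CX k.+1 c' ->
    (forall v, v != cube1 k.+1 -> c v = c' v) ->
    c (cube1 k.+1) = c' (cube1 k.+1)); last first.
  (* Then X is isomorphic to no nilmanifold of degree k. *)
  exists 1 => // Z f phi theta _ [_ thetaM [theta' [thetaK _ _ _]]] _ _.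
  case: ndet => c c' /thetaM Cc /thetaM Cc' cc'; apply: (can_inj thetaK).
  by apply: (nm_cubes_top Cc Cc') => v /cc' /= ->.
have [eps eps0 epsP] := correlation_gowers (compact_nilspace_compact Xnil)
  (@compact_nilspace_closed _ _ Xnil k.+1) det delta0 C0.
exists eps => // Z f phi theta f1 [_ _ [theta' [_ theta'K _ theta'M]]] FL.
rewrite inner_pns_val gowers_normE -(gowers_form_surj (@pns_surj _ _ _ phi)) => fF.
apply: (epsP _ _ (theta' \o ns_map (pns_seq phi))
  (fun x => ns_fun (theta x) : R[i])) => //.
- by move=> x; apply: ns_bounded.
- move=> y h; apply: (theta'M _ (fun v => _)).
  exact: (@ns_polynomial _ _ _ (pns_seq phi) k.+1 _ (Dcubes1_shift y h)).
- by under eq_mean do rewrite /= theta'K.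
Qed.

Theorem proposition4p11 (R : realType) (E : CFR_enumeration R) (k : nat)
    (delta C : R) (delta_gt0 : 0 < delta) (C_gt0 : 0 < C) :
  exists2 eps : R, 0 < eps &
    forall (Z : finZmodType) (f : Z -> R[i]),
      (forall x, `|f x| <= 1) ->
      (exists2 phi : projected_nilsequence R k Z,
         complexity_le E C (pns_seq phi) &
         delta%:C <= `|inner f (pns_val phi)|) ->
      eps%:C <= gowers_norm k.+1 f.
Proof.
(* [Num.bound C] exceeds C, so only finitely many indices occur and the least of their bounds
   serves. *)
suff H n : exists2 eps : R, 0 < eps &
    forall i, (0 < i < n)%N -> correlation_bound E k delta C eps i.
  have [eps eps0 epsP] := H (Num.bound C).
  exists eps => // Z f f1 [phi [i [i0 iC] [theta thetaI FL]] ffphi].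
  apply: (epsP i _ Z f phi theta) => //; rewrite i0 /= -(ltr_nat R).
  by rewrite (le_lt_trans iC) // archi_boundP // ltW.
elim: n => [|n [eps eps0 epsP]]; first by exists 1 => // i; rewrite ltn0 andbF.
(* Index 0 numbers no representative, so the range is empty here. *)
have [->|n0] := posnP n; first by exists 1 => // -[|i].
have [e e0 eP] := exists_correlation_bound E k n0 delta_gt0 C_gt0.
exists (Num.min e eps); first by rewrite lt_min e0.
move=> i /andP[i0]; rewrite ltnS leq_eqVlt => /predU1P[-> | i_n] Z f phi theta *.
  by apply: le_trans (eP Z f phi theta _ _ _ _) => //; rewrite lecR ge_min lexx.
apply: le_trans (epsP i _ Z f phi theta _ _ _ _) => //; last by rewrite i0.
by rewrite lecR ge_min lexx orbT.
Qed.
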